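(* $\mathbf Y^*=\langle\mathcal P,\le,[1]+[1]\rangle$ has the maximal definability property with respect to $\#$: the first-order definable relations of $\mathbf Y^*$ coincide with the first-order definable relations of $\langle\mathcal P,+_\#,\times_\#\rangle$, i.e. $\mathrm{Def}(\mathcal P,\le,[1]+[1])=\mathrm{Def}(\mathcal P,+_\#,\times_\#)$.
   Context: $\mathcal P$ is the set of all integer partitions, including the empty partition $\emptyset$; a partition is a nonincreasing finite sequence of positive integers (its parts). $[n]$ denotes the partition with a single part $n$, and $m[n]$ the partition with exactly $m$ parts equal to $n$. Every nonempty partition has a unique canonical representation $\sigma=\sum_{i=1}^k m_i[n_i]$ with $n_1>\dots>n_k\ge1$, meaning part $n_i$ occurs exactly $m_i\ge1$ times. Let $p_1=2,p_2=3,\dots$ enumerate the primes. Define the bijection $\#:\mathcal P\to\mathbb N$ by $\#\emptyset=0$; $\#(m[1])=p_1^{m-1}$ for $m\ge1$; and $\#\sigma=\prod_{i=1}^k p_{n_i}^{m_i}$ if $\sigma=\sum m_i[n_i]$ has some part $n_i\neq1$. The ternary relations $+_\#,\times_\#$ on $\mathcal P$ are: $(\rho,\sigma,\pi)\in+_\#$ iff $\#\rho+\#\sigma=\#\pi$, and $(\rho,\sigma,\pi)\in\times_\#$ iff $\#\rho\cdot\#\sigma=\#\pi$. Young's lattice $\mathbf Y=\langle\mathcal P,\le\rangle$ has $(s_1,\dots,s_r)\le(n_1,\dots,n_t)$ iff $r\le t$ and $s_i\le n_i$ for all $i\le r$; $\mathbf Y^*$ is $\mathbf Y$ with a constant symbol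 for $[1]+[1]=(1,1)$. For a structure $A$, $\mathrm{Def}(A)$ denotes the set of all relations (of all arities) on its universe definable by first-order formulas without parameters. *)

(* Defs.v *)
From mathcomp Require Import all_boot.
Set Implicit Arguments. Unset Strict Implicit. Unset Printing Implicit Defensive.

Definition is_part (s : seq nat) : bool := sorted geq s && all (fun x => 0 < x) s.
Definition ypartition := {s : seq nat | is_part s}.

Definition young_le (a b : ypartition) : Prop :=
  size (sval a) <= size (sval b) /\
  forall i, i < size (sval a) -> nth 0 (sval a) i <= nth 0 (sval b) i.

Definition two_ones : ypartition := exist _ [:: 1; 1] isT.

(* ---------- The n-th prime, p_1 = 2, p_2 = 3, ... ---------- *)
Definition next_prime (p : nat) : nat :=
  ex_minn (let: exist2 q Hq Pq := prime_above p in
           ex_intro (fun q => (p < q) && prime q) q (introT andP (conj Hq Pq))).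
Definition nth_prime (n : nat) : nat := iter n next_prime 1.

Definition code_seq (s : seq nat) : nat :=
  if s is [::] then 0
  else if has (fun x => x != 1) s then \prod_(x <- s) nth_prime x
  else 2 ^ (size s).-1.
Definition code (a : ypartition) : nat := code_seq (sval a).

Definition plus_code (a b c : ypartition) : Prop := code a + code b = code c.
Definition times_code (a b c : ypartition) : Prop := code a * code b = code c.

Record signature := Signature {
  rsym : Type;
  rar : rsym -> nat;
  csym : Type
}.

Record structure (S : signature) (U : Type) := Structure {
  rint : forall r : rsym S, ('I_(rar r) -> U) -> Prop;
  cint : csym S -> U
}.

Inductive term (S : signature) :=
  | TVar of nat
  | TCst of csym S.

Inductive formula (S : signature) :=
  | FFalse
  | FEq of term S & term S
  | FRel (r : rsym S) of ('I_(rar r) -> term S)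
  | FNot of formula S
  | FAnd of formula S & formula S
  | FOr of formula S & formula S
  | FImp of formula S & formula S
  | FEx of nat & formula S
  | FAll of nat & formula S.

Definition upd (U : Type) (e : nat -> U) (n : nat) (a : U) : nat -> U :=
  fun m => if m == n then a else e m.

Definition teval S U (A : structure S U) (e : nat -> U) (t : term S) : U :=
  match t with TVar n => e n | TCst c => @cint _ _ A c end.

Fixpoint sat S U (A : structure S U) (e : nat -> U) (f : formula S) : Prop :=
  match f with
  | FFalse => False
  | FEq t1 t2 => teval A e t1 = teval A e t2
  | FRel r ts => @rint _ _ A r (fun i => teval A e (ts i))
  | FNot g => ~ sat A e g
  | FAnd g h => sat A e g /\ sat A e h
  | FOr g h => sat A e g \/ sat A e h
  | FImp g h => sat A e g -> sat A e h
  | FEx n g => exists a, sat A (upd e n a) g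
  | FAll n g => forall a, sat A (upd e n a) g
  end.

(* A k-ary relation R is definable (without parameters) in A iff some formula
   phi, whose truth depends only on variables 0..k-1, defines it. *)
Definition definable S U (A : structure S U) (k : nat) (R : ('I_k -> U) -> Prop) : Prop :=
  exists phi : formula S, forall e : nat -> U,
    R (fun i : 'I_k => e (nat_of_ord i)) <-> sat A e phi.

Definition sig_Y : signature := Signature (fun _ : unit => 2) unit.
Definition Ystar : structure sig_Y ypartition :=
  Structure (S := sig_Y) (fun _ (v : 'I_2 -> ypartition) => young_le (v (inord 0)) (v (inord 1)))
            (fun _ => two_ones).

Definition sig_A : signature := Signature (fun _ : bool => 3) void.
Definition Arith : structure sig_A ypartition :=
  Structure (S := sig_A)
    (fun (r : bool) (v : 'I_3 -> ypartition) =>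
       if r then plus_code (v (inord 0)) (v (inord 1)) (v (inord 2))
       else times_code (v (inord 0)) (v (inord 1)) (v (inord 2)))
    (fun c : void => match c with end).

(* Main.v *)
Require Import Defs.
From Stdlib Require Import FunctionalExtensionality.
From mathcomp Require Import all_boot zify.
Set Implicit Arguments. Unset Strict Implicit. Unset Printing Implicit Defensive.

(* In both structures one can quantify over finite nonincreasing sequences of
   numbers, with definable addition, multiplication and access to the i-th term;
   this suffices to define the relation "x represents a partition s and
   #s = n", through the sequences of partial products and of consecutive primes.

   In Young's lattice a partition names its largest part, and is itself a
   nonincreasing sequence.  The constant (1,1) separates rows from columns, so
   widths and heights can be compared; rectangles give the relation "the part
   number (height b) of a is at least (width c)", staircases identify heights
   with widths, and arithmetic progressions then define addition and
   multiplication of widths.  In arithmetic a partition names its code, and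
   Goedel's beta function provides the sequences. *)

(** * Closure properties of definable relations *)

Section Definability.
Context {S : signature} {U : Type}.
Implicit Types (A : structure S U) (P Q : (nat -> U) -> Prop) (e : nat -> U).

(* Predicates are stated on environments, so that quantification over [x] binds
   variable 0 and shifts the others. *)
Definition Dfn A P := exists phi : formula S, forall e, P e <-> sat A e phi.

Definition term_var (t : term S) := if t is TVar n then n.+1 else 0.

Lemma teval_agree A (t : term S) e e' :
  (forall n, n < term_var t -> e n = e' n) -> teval A e t = teval A e' t.
Proof. by case: t => [n|c] //= ->. Qed.

(** A formula mentions finitely many variables, as relation symbols have finite arity. The bound is
    what allows fresh names to be chosen later. *)
Lemma sat_agree A (phi : formula S) : exists N, forall e e',
  (forall n, n < N -> e n = e' n) -> (sat A e phi <-> sat A e' phi).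
Proof.
have two (f g : formula S) (conn : Prop -> Prop -> Prop) :
    (forall X X' Y Y', (X <-> X') -> (Y <-> Y') -> (conn X Y <-> conn X' Y')) ->
    (exists N, forall e e', (forall n, n < N -> e n = e' n) ->
       (sat A e f <-> sat A e' f)) ->
    (exists N, forall e e', (forall n, n < N -> e n = e' n) ->
       (sat A e g <-> sat A e' g)) ->
    exists N, forall e e', (forall n, n < N -> e n = e' n) ->
       (conn (sat A e f) (sat A e g) <-> conn (sat A e' f) (sat A e' g)).
  move=> Hc [N HN] [M HM]; exists (maxn N M) => e e' E; apply: Hc.
    by apply: HN => n Hn; apply: E; rewrite leq_max Hn.
  by apply: HM => n Hn; apply: E; rewrite leq_max Hn orbT.
have upd_agree N n a e e' : (forall k, k < N -> e k = e' k) ->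
    forall k, k < N -> upd e n a k = upd e' n a k.
  by move=> E k kN; rewrite /upd; case: eqP => // _; apply: E.
elim: phi => [|t1 t2|r ts|g [N IH]|g IHg h IHh|g IHg h IHh|g IHg h IHh
             |n g [N IH]|n g [N IH]] /=.
- by exists 0.
- exists (maxn (term_var t1) (term_var t2)) => e e' E.
  rewrite (@teval_agree A t1 e e') ?(@teval_agree A t2 e e') //
    => n Hn; apply: E; by rewrite leq_max Hn ?orbT.
- exists (\max_i term_var (ts i)) => e e' E.
  suff -> : (fun i => teval A e (ts i)) = (fun i => teval A e' (ts i)) by [].
  apply: functional_extensionality => i; apply: teval_agree => n Hn.
  by apply: E; apply: leq_trans Hn (leq_bigmax i).
- by exists N => e e' /IH->.
- by apply: (two g h and); tauto.
- by apply: (two g h or); tauto.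
- by apply: (two g h (fun X Y => X -> Y)); tauto.
- exists N => e e' E; split=> -[a Ha]; exists a; move: Ha;
    by rewrite (IH _ (upd e' n a)) //; apply: upd_agree.
- exists N => e e' E; split=> H a; move: (H a);
    by rewrite (IH _ (upd e' n a)) //; apply: upd_agree.
Qed.

Definition term_ren (r : nat -> nat) (t : term S) :=
  if t is TVar n then TVar S (r n) else t.

(** Since [r] need not be injective, each bound variable gets a fresh name to avoid capture; under a
    quantifier [r] changes, so the induction is over all [r]. *)
Lemma sat_ren A (phi : formula S) (r : nat -> nat) : exists psi : formula S,
  forall e, sat A e psi <-> sat A (fun n => e (r n)) phi.
Proof.
have teval_ren q e (t : term S) :
  teval A e (term_ren q t) = teval A (fun n => e (q n)) t by case: t.
(* The fresh name [m] exceeds the images of all variables of the body. *)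
have fresh (g : formula S) n q : exists m, forall e a,
    sat A (fun k => upd e m a (upd q n m k)) g <->
    sat A (upd (fun k => e (q k)) n a) g.
  have [N HN] := sat_agree A g.
  exists (\max_(i < N) q i).+1 => e a; apply: HN => k kN; rewrite /upd.
  case: (k == n); first by rewrite eqxx.
  case: eqP => // E; have := @leq_bigmax _ (fun i : 'I_N => q i) (Ordinal kN).
  by rewrite /= E ltnn.
elim: phi r => [|t1 t2|b ts|g IH|g IHg h IHh|g IHg h IHh|g IHg h IHh
             |n g IH|n g IH] r /=.
- by exists (FFalse S).
- by exists (FEq (term_ren r t1) (term_ren r t2)) => e /=; rewrite !teval_ren.
- exists (FRel (fun i => term_ren r (ts i))) => e /=.
  suff -> : (fun i => teval A e (term_ren r (ts i))) =
            (fun i => teval A (fun n => e (r n)) (ts i)) by [].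
  by apply: functional_extensionality => i; apply: teval_ren.
- by have [g' H] := IH r; exists (FNot g') => e /=; rewrite H.
- have [[g' H] [h' H']] := (IHg r, IHh r).
  by exists (FAnd g' h') => e /=; rewrite H H'.
- have [[g' H] [h' H']] := (IHg r, IHh r).
  by exists (FOr g' h') => e /=; rewrite H H'.
- have [[g' H] [h' H']] := (IHg r, IHh r).
  by exists (FImp g' h') => e /=; rewrite H H'.
- have [m Hm] := fresh g n r; have [g' H] := IH (upd r n m).
  by exists (FEx m g') => e /=; split=> -[a Ha]; exists a; [apply/Hm/H|apply/H/Hm].
- have [m Hm] := fresh g n r; have [g' H] := IH (upd r n m).
  by exists (FAll m g') => e /=; split=> Ha a; [apply/Hm/H|apply/H/Hm].
Qed.

Context (A : structure S U).

Lemma D_iff P Q : (forall e, P e <-> Q e) -> Dfn A Q -> Dfn A P.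
Proof. by move=> E [phi H]; exists phi => e; rewrite E. Qed.

Lemma D_ren P (r : nat -> nat) : Dfn A P -> Dfn A (fun e => P (fun n => e (r n))).
Proof.
move=> [phi H]; have [psi Hpsi] := sat_ren A phi r.
by exists psi => e; rewrite H Hpsi.
Qed.

Lemma D_not P : Dfn A P -> Dfn A (fun e => ~ P e).
Proof. by move=> [f Hf]; exists (FNot f) => e /=; rewrite Hf. Qed.

Lemma D_and P Q : Dfn A P -> Dfn A Q -> Dfn A (fun e => P e /\ Q e).
Proof. by move=> [f Hf] [g Hg]; exists (FAnd f g) => e /=; rewrite Hf Hg. Qed.

Lemma D_or P Q : Dfn A P -> Dfn A Q -> Dfn A (fun e => P e \/ Q e).
Proof. by move=> [f Hf] [g Hg]; exists (FOr f g) => e /=; rewrite Hf Hg. Qed.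

Lemma D_imp P Q : Dfn A P -> Dfn A Q -> Dfn A (fun e => P e -> Q e).
Proof. by move=> [f Hf] [g Hg]; exists (FImp f g) => e /=; rewrite Hf Hg. Qed.

Lemma D_eq i j : Dfn A (fun e => e i = e j).
Proof. by exists (FEq (TVar S i) (TVar S j)). Qed.

(** Passes from shifted environments to named quantifiers: [N] lies beyond the variables of [phi],
    so variable 0 can become [N] while the others move down by one. *)
Lemma sat_bind (P : U -> (nat -> U) -> Prop) :
  Dfn A (fun e => P (e 0) (fun n => e n.+1)) ->
  exists m (psi : formula S), forall e a, sat A (upd e m a) psi <-> P a e.
Proof.
move=> [phi Hphi]; have [N HN] := sat_agree A phi.
have [psi Hpsi] := sat_ren A phi (fun k => if k is j.+1 then j else N).
exists N, psi => e a; rewrite Hpsi.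
rewrite (HN _ (fun k => if k is j.+1 then e j else a)) -?Hphi //.
by case=> [|k] kN; rewrite /upd ?eqxx // ltn_eqF // ltnW.
Qed.

Lemma D_ex (P : U -> (nat -> U) -> Prop) :
  Dfn A (fun e => P (e 0) (fun n => e n.+1)) -> Dfn A (fun e => exists a, P a e).
Proof.
move=> /sat_bind[m [psi H]].
by exists (FEx m psi) => e; split=> -[a Ha]; exists a; apply/H.
Qed.

Lemma D_all (P : U -> (nat -> U) -> Prop) :
  Dfn A (fun e => P (e 0) (fun n => e n.+1)) -> Dfn A (fun e => forall a, P a e).
Proof.
move=> /sat_bind[m [psi H]].
by exists (FAll m psi) => e; split=> Ha a; apply/H.
Qed.

(* Elements name natural numbers through [val], which need not be injective;
   surjectivity turns quantifiers over the universe into quantifiers over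
   numbers. *)
Class numbering (val : U -> nat) : Prop := Numbering {
  val_surj : forall n, exists a, val a = n;
  D_val_le : forall i j, Dfn A (fun e => val (e i) <= val (e j))
}.

Context (val : U -> nat) {Hval : numbering val}.

Class def_fun1 (f : nat -> nat) : Prop :=
  D_fun1 : forall i j, Dfn A (fun e => f (val (e i)) = val (e j)).
Class def_fun2 (f : nat -> nat -> nat) : Prop :=
  D_fun2 : forall i j k, Dfn A (fun e => f (val (e i)) (val (e j)) = val (e k)).
(** [ent x n] is meant as term [n] of the sequence named by [x]. *)
Class def_app (ent : U -> nat -> nat) : Prop :=
  D_app : forall i j k, Dfn A (fun e => ent (e i) (val (e j)) = val (e k)).
Class def_pred (R : nat -> Prop) : Prop :=
  D_pred : forall i, Dfn A (fun e => R (val (e i))).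

Definition DT (t : (nat -> U) -> nat) :=
  Dfn A (fun e => t (fun n => e n.+1) = val (e 0)).

Lemma D_exn (P : nat -> (nat -> U) -> Prop) :
  Dfn A (fun e => P (val (e 0)) (fun n => e n.+1)) ->
  Dfn A (fun e => exists n, P n e).
Proof.
move=> /(@D_ex (fun a => P (val a))); apply: D_iff => e; split=> -[].
  by move=> n Hn; have [a E] := val_surj n; exists a; rewrite E.
by move=> a Ha; exists (val a).
Qed.

Lemma D_alln (P : nat -> (nat -> U) -> Prop) :
  Dfn A (fun e => P (val (e 0)) (fun n => e n.+1)) ->
  Dfn A (fun e => forall n, P n e).
Proof.
move=> /(@D_all (fun a => P (val a))); apply: D_iff => e; split=> // H n.
by have [a <-] := val_surj n.
Qed.

Lemma D_subst (R : nat -> (nat -> U) -> Prop) t :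
  Dfn A (fun e => R (val (e 0)) (fun n => e n.+1)) -> DT t ->
  Dfn A (fun e => R (t e) e).
Proof.
move=> HR Ht.
apply: (@D_iff _ (fun e => exists n, t e = n /\ R n e)).
  by move=> e; split=> [|[n [-> //]]]; exists (t e).
by apply: (@D_exn (fun n e => t e = n /\ R n e)); apply: D_and.
Qed.

Lemma DT_shift t : DT t -> DT (fun e => t (fun n => e n.+1)).
Proof. exact: (@D_ren _ (fun n => if n is k.+1 then k.+2 else 0)). Qed.

Lemma D_subst2 (R : nat -> nat -> (nat -> U) -> Prop) t u :
  Dfn A (fun e => R (val (e 1)) (val (e 0)) (fun n => e n.+2)) ->
  DT t -> DT u -> Dfn A (fun e => R (t e) (u e) e).
Proof.
move=> HR Ht Hu; apply: (@D_subst (fun n e => R n (u e) e)) => //.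
apply: (@D_subst (fun n e => R (val (e 0)) n (fun n => e n.+1))) => //.
exact: DT_shift.
Qed.

Lemma DT_val i : DT (fun e => val (e i)).
Proof.
apply: (@D_iff _ (fun e => val (e i.+1) <= val (e 0) /\ val (e 0) <= val (e i.+1))).
  by move=> e; split=> [->//|[H H']]; apply/anti_leq/andP.
by apply: D_and; apply: D_val_le.
Qed.

Lemma D_le t u : DT t -> DT u -> Dfn A (fun e => t e <= u e).
Proof. by apply: (@D_subst2 (fun n m _ => n <= m)); apply: D_val_le. Qed.

Lemma D_eqn t u : DT t -> DT u -> Dfn A (fun e => t e = u e).
Proof.
apply: (@D_subst2 (fun n m _ => n = m)).
(* Unfolded, [DT_val 0] is the definability of [val (e 1) = val (e 0)]. *)
exact: (DT_val 0).
Qed.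

Lemma D_pred1 R {HR : def_pred R} t : DT t -> Dfn A (fun e => R (t e)).
Proof. by apply: (@D_subst (fun n _ => R n)). Qed.

Lemma DT_fun1 f {Hf : def_fun1 f} t : DT t -> DT (fun e => f (t e)).
Proof.
by move=> /DT_shift; apply: (@D_subst (fun n e => f n = val (e 0))).
Qed.

Lemma DT_fun2 f {Hf : def_fun2 f} t u :
  DT t -> DT u -> DT (fun e => f (t e) (u e)).
Proof.
move=> /DT_shift Ht /DT_shift.
by apply: (@D_subst2 (fun n m e => f n m = val (e 0)) _ _ _ Ht).
Qed.

Lemma DT_app ent {Hent : def_app ent} i t : DT t -> DT (fun e => ent (e i) (t e)).
Proof.
move=> /DT_shift.
by apply: (@D_subst (fun n e => ent (e i.+1) n = val (e 0))).
Qed.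

(** Order alone suffices: the successor is larger, and nothing lies strictly between. *)
#[global] Instance def_succ : def_fun1 succn.
Proof.
move=> i j.
apply: (@D_iff _ (fun e => ~ (val (e j) <= val (e i)) /\
    forall n, (n <= val (e i)) \/ (val (e j) <= n))); last first.
  apply: D_and; first by apply: D_not; apply: D_val_le.
  apply: (@D_alln (fun n e => _ \/ _)).
  by apply: D_or; apply: D_val_le.
move=> e; split=> [<-|[H /(_ (val (e i)).+1)]]; last by lia.
by split=> [|n]; lia.
Qed.

Lemma DT_const n : DT (fun=> n).
Proof.
elim: n => [|n IH]; last exact: (DT_fun1 (f := succn)).
apply: (@D_iff _ (fun e => forall n, val (e 0) <= n)).
  by move=> e; split=> [<-|/(_ 0)] //; case: (val _).
by apply: (@D_alln (fun n e => _)); apply: D_val_le.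
Qed.
End Definability.

(** Recursion on the shape of the predicate. Quantifiers over numbers are tried before those over
    elements; atoms of unknown shape remain as goals. *)
Ltac dfn := cbv beta; lazymatch goal with
  | |- Dfn _ (fun e => ~ _) => apply D_not; dfn
  | |- Dfn _ (fun e => _ /\ _) => apply D_and; dfn
  | |- Dfn _ (fun e => _ \/ _) => apply D_or; dfn
  | |- Dfn _ (fun e => exists x : nat, @?P e x) =>
      refine (D_exn (P := fun x e => P e x) _); dfn
  | |- Dfn _ (fun e => exists x, @?P e x) =>
      apply (D_ex (P := fun x e => P e x)); dfn
  | |- Dfn _ (fun e => forall x : nat, @?P e x) =>
      refine (D_alln (P := fun x e => P e x) _); dfn
  | |- Dfn _ (fun e => is_true (_ <= _)) => refine (D_le _ _); dfn
  | |- Dfn _ (fun e => @eq nat _ _) => refine (D_eqn _ _); dfn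
  | |- Dfn _ (fun e => is_true (?p (@?t e))) =>
      refine (D_pred1 (R := fun n => is_true (p n)) _); dfn
  | |- Dfn _ (fun e => @?P e -> @?Q e) => apply D_imp; dfn
  | |- Dfn _ (fun e => forall x, @?P e x) =>
      apply (D_all (P := fun x e => P e x)); dfn
  | |- DT _ _ (fun e => _ (e _)) => refine (DT_val _)
  | |- DT _ _ (fun e => _ (e _) _) => refine (DT_app _ _); dfn
  | |- DT _ _ (fun e => ?f (@?t e) (@?u e)) => refine (DT_fun2 (f := f) _ _); dfn
  | |- DT _ _ (fun e => ?f (@?t e)) => refine (DT_fun1 (f := f) _); dfn
  | |- DT ?A ?v (fun e => ?n) => exact (DT_const (A := A) (val := v) n)
  | |- _ => idtac
  end.

(** * Defining the code of a represented partition *)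

Lemma next_primeP p q : next_prime p = q <->
  [/\ p < q, prime q & forall r, p < r -> prime r -> q <= r].
Proof.
rewrite /next_prime; case: ex_minnP => m /andP[pm prm] mmin.
have Hm r : p < r -> prime r -> m <= r by move=> pr prr; apply: mmin; rewrite pr.
split=> [<-//|[pq prq qmin]].
by apply/anti_leq; rewrite Hm //= qmin.
Qed.

Lemma ltn_next_prime p : p < next_prime p.
Proof. by have [] := (next_primeP p _).1 erefl. Qed.

Lemma prime_next_prime p : prime (next_prime p).
Proof. by have [] := (next_primeP p _).1 erefl. Qed.

Lemma nth_prime1 : nth_prime 1 = 2.
Proof. by apply/next_primeP. Qed.

Lemma nth_prime_gt0 n : 0 < nth_prime n.
Proof. by case: n => //= n; apply: leq_ltn_trans (ltn_next_prime _). Qed.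

Lemma nth_prime_predn n : nth_prime n.-1 <= nth_prime n.
Proof. by case: n => [|n] //=; apply/ltnW/ltn_next_prime. Qed.

(** [h] lists the primes downwards and ends in [nth_prime 0 = 1]. *)
Lemma nth_prime_unfold (h : nat -> nat) n :
  h n = 1 -> (forall i, i < n -> h i = next_prime (h i.+1)) -> h 0 = nth_prime n.
Proof.
elim: n h => [|n IH] h hn hi //.
by rewrite hi // (IH (fun i => h i.+1)) // => i il; apply: hi.
Qed.

Lemma nth_prime_prod (g h : nat -> nat) l :
  h l = 1 -> (forall i, i < l -> h i = nth_prime (g i) * h i.+1) ->
  h 0 = \prod_(x <- mkseq g l) nth_prime x.
Proof.
elim: l g h => [|l IH] g h hl hi; first by rewrite big_nil.
rewrite hi // /mkseq /= big_cons (IH (fun i => g i.+1) (fun i => h i.+1)) //.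
  by rewrite (iotaDl 1 0) -map_comp.
by move=> i il; apply: hi.
Qed.

(** On [m] ones the prime product is [2 ^ m] but the code [2 ^ m.-1]; writing [2 * n] for the
    product removes the exponent, so that only the product has to be defined. *)
Lemma code_seqP s n : code_seq s = n <->
  (size s = 0 /\ n = 0) \/
  ((exists i, i < size s /\ nth 0 s i <> 1) /\ n = \prod_(x <- s) nth_prime x) \/
  (0 < size s /\ (forall i, i < size s -> nth 0 s i = 1) /\
   2 * n = \prod_(x <- s) nth_prime x).
Proof.
rewrite /code_seq; case: s => [|y s].
  by split=> [<-|[[_ ->]|[[[i [//]]]|[//]]]] //; left.
set t := y :: s.
have prod1 : (forall i, i < size t -> nth 0 t i = 1) ->
    \prod_(x <- t) nth_prime x = 2 * 2 ^ (size t).-1.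
  move=> H; rewrite -expnS /=; rewrite -(card_ord (size s).+1) -prod_nat_const.
  rewrite (big_nth 0) big_mkord; apply: eq_bigr => i _.
  by rewrite H // nth_prime1.
case: ifPn => [/(has_nthP 0)[i it /eqP ti]|/hasPn H].
  split=> [<-|]; first by right; left; split => //; exists i.
  by move=> [[//]|[[//]|[_ [H]]]]; case: ti; apply: H.
have {}H i : i < size t -> nth 0 t i = 1.
  by move=> it; apply/eqP; have := H _ (mem_nth 0 it); rewrite negbK.
rewrite prod1 //; split=> [<-|]; first by right; right.
move=> [[//]|[[[i [it]]]|[_ [_ ]]]]; first by rewrite H.
lia.
Qed.

Section Coding.
Context {S : signature} {U : Type} {A : structure S U} {val : U -> nat}.
Context {ent : U -> nat -> nat} {Hval : numbering A val}.
Context {Hadd : def_fun2 A val addn} {Hmul : def_fun2 A val muln}.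
Context {Hent : def_app A val ent}.

(* Only nonincreasing sequences are available in Young's lattice, where they are
   the partitions themselves; hence the sequences below run backwards. *)
Definition represents_monotone := forall (f : nat -> nat) N,
  (forall i, f i.+1 <= f i) -> exists x, forall i, i < N -> ent x i = f i.

Context (Hrep : represents_monotone).

#[local] Instance def_prime : def_pred A val (fun n => prime n).
Proof.
move=> i; apply: (@D_iff _ _ _ _ (fun e => 1 < val (e i) /\
    forall m n : nat, m * n = val (e i) -> m = 1 \/ n = 1)); last by dfn.
move=> e; split=> [/primeP[p1 pd]|[p1 pd]].
  split=> // m n E.
  have /pd/orP[/eqP->|/eqP Em] : m %| val (e i) by rewrite -E dvdn_mulr.
    by left.
  by right; move: E; rewrite Em; nia.
apply/primeP; split=> // d /dvdnP[k E].
by have [k1|->] := pd _ _ (esym E); rewrite ?eqxx // E k1 mul1n eqxx orbT.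
Qed.

#[local] Instance def_next_prime : def_fun1 A val next_prime.
Proof.
move=> i j; apply: (@D_iff _ _ _ _ (fun e =>
    val (e i) < val (e j) /\ prime (val (e j)) /\
    forall r : nat, val (e i) < r -> prime r -> val (e j) <= r)); last by dfn.
by move=> e; rewrite next_primeP; split=> [[]|[? []]].
Qed.

#[local] Instance def_nth_prime : def_fun1 A val nth_prime.
Proof.
move=> i j; apply: (@D_iff _ _ _ _ (fun e => exists x : U,
    ent x 0 = val (e j) /\ ent x (val (e i)) = 1 /\
    forall k : nat, k < val (e i) -> ent x k = next_prime (ent x k.+1)));
  last by dfn.
move=> e; split=> [<-|[x [<- [xn xk]]]].
  have mono k : nth_prime (val (e i) - k.+1) <= nth_prime (val (e i) - k).
    by rewrite subnS nth_prime_predn.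
  have [x Hx] := @Hrep (fun k => nth_prime (val (e i) - k)) (val (e i)).+1
    mono.
  exists x; rewrite !Hx // subn0 subnn; split=> //; split=> // k kn.
  by rewrite !Hx ?ltnS ?(ltnW kn) // -[_ - k]prednK ?subn_gt0 // -subnS.
exact/esym/nth_prime_unfold.
Qed.

(** The index [size (sval s)] is included: there [nth] gives its default 0, which marks the end of
    the partition. *)
Definition represents x (s : ypartition) :=
  forall i, i <= size (sval s) -> ent x i = nth 0 (sval s) i.

Definition codes x n := exists s, represents x s /\ code s = n.

(** Parts are positive, so [l], the first index with a zero, is the number of parts; [f] holds the
    products of primes over the parts from each index on. *)
Lemma codesP x n : codes x n <-> exists l : nat,
  ent x l = 0 /\ (forall i : nat, i < l -> 0 < ent x i) /\
  (forall i : nat, i < l -> ent x i.+1 <= ent x i) /\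
  exists f : U, ent f l = 1 /\
    (forall i : nat, i < l -> ent f i = nth_prime (ent x i) * ent f i.+1) /\
    ((l = 0 /\ n = 0) \/
     ((exists i : nat, i < l /\ ~ ent x i = 1) /\ n = ent f 0) \/
     (0 < l /\ (forall i : nat, i < l -> ent x i = 1) /\ 2 * n = ent f 0)).
Proof.
split.
  move=> [[s sP] [Hx Hs]]; have /andP[ssort spos] := sP.
  have {}Hs := (code_seqP s n).1 Hs; rewrite /represents /= in Hx.
  have Hn i : i < size s -> ent x i = nth 0 s i by move=> il; apply/Hx/ltnW.
  exists (size s); split; first by rewrite Hx ?nth_default.
  split; first by move=> i il; rewrite Hn //; apply: (all_nthP 0 spos).
  split; first by move=> i il; rewrite (Hn i) // Hx //; case: (ltngtP i.+1 (size s)) il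
    => // [il _|-> _]; [apply: (sortedP 0 ssort)|rewrite [leqLHS]nth_default].
  (* Products over suffixes rather than prefixes, because [Hrep] asks for a nonincreasing
     sequence. *)
  pose g i := \prod_(x <- drop i s) nth_prime x.
  have gS i : i < size s -> g i = nth_prime (nth 0 s i) * g i.+1.
    by move=> il; rewrite /g (drop_nth 0) // big_cons.
  have gmon i : g i.+1 <= g i.
    case: (ltnP i (size s)) => [/gS->|il]; first by rewrite leq_pmull ?nth_prime_gt0.
    by rewrite /g !drop_oversize // leqW.
  have [f Hf] := @Hrep g (size s).+1 gmon.
  exists f; split; first by rewrite Hf // /g drop_size big_nil.
  split; first by move=> i il; rewrite (Hn i il) (Hf i (ltnW il)) (Hf i.+1 il) gS.
  rewrite Hf // /g drop0; case: Hs => [|[[[i [il H]] H']|[s0 [H H']]]].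
  - by left.
  - by right; left; split=> //; exists i; rewrite Hn.
  - by right; right; split=> //; split=> // i il; rewrite Hn // H.
move=> [l [x0 [xpos [xmon [f [fl [fi Hf]]]]]]].
have nthE i : i < l -> nth 0 (mkseq (ent x) l) i = ent x i by apply: nth_mkseq.
have sP : is_part (mkseq (ent x) l).
  apply/andP; split.
    apply/(sortedP 0) => i; rewrite size_mkseq => il.
    by rewrite !nthE ?(ltnW il) // /geq /= xmon // ltnW.
  by apply/(all_nthP 0) => i; rewrite size_mkseq => il; rewrite nthE ?xpos.
exists (exist is_part _ sP); split=> [i|]; rewrite /= ?size_mkseq.
  rewrite leq_eqVlt => /orP[/eqP->|/nthE//].
  by rewrite x0 nth_default // size_mkseq.
apply/code_seqP; rewrite size_mkseq -(nth_prime_prod fl fi).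
case: Hf => [|[[[i [il H]] H']|[s0 [H H']]]]; first by left.
  by right; left; split=> //; exists i; rewrite nthE.
by right; right; split=> //; split=> // i il; rewrite nthE // H.
Qed.

Lemma D_codes i j : Dfn A (fun e => codes (e i) (val (e j))).
Proof. by apply: (D_iff (fun e => codesP _ _)); dfn. Qed.
End Coding.

(** * Arithmetic in Young's lattice *)

Definition entry (a : ypartition) (i : nat) := nth 0 (sval a) i.
Definition width a := entry a 0.
Definition height (a : ypartition) := size (sval a).

Lemma entry_gt0 a i : (0 < entry a i) = (i < height a).
Proof.
case: a => s sP; rewrite /entry /height /=; have /andP[_ spos] := sP.
by case: (ltnP i) => [|/(nth_default 0)-> //]; apply: (all_nthP 0 spos).
Qed.

Lemma entry_default a i : height a <= i -> entry a i = 0.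
Proof. exact: nth_default. Qed.

Lemma entryS a i : entry a i.+1 <= entry a i.
Proof.
case: (ltnP i.+1 (height a)) => [|/entry_default-> //].
by case: a => s sP; have /andP[ssort _] := sP; apply: (sortedP 0 ssort).
Qed.

Lemma entry_anti a i j : i <= j -> entry a j <= entry a i.
Proof.
move: i j; apply: (@homo_leq _ _ (fun m n => n <= m)) => //; last exact: entryS.
by move=> n m p nm /leq_trans; apply.
Qed.

(** Parts are positive and [entry] pads with zeros, so the pointwise comparison already forces the
    one between sizes. *)
Lemma young_leP a b : young_le a b <-> forall i, entry a i <= entry b i.
Proof.
split=> [[_ H] i|H]; first by case: (ltnP i (height a)) => [/H|/entry_default->].
split=> [|i _]; last exact: H.
change (height a <= height b); rewrite leqNgt -entry_gt0; apply/negP => pos.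
by have := H (height b); rewrite (entry_default (leqnn _)) leqNgt pos.
Qed.

(** Zeros of [f] before [N] do no harm: only zeros follow them, and [entry] reads zeros past the
    last part. *)
Lemma part_of (f : nat -> nat) N : (forall i, f i.+1 <= f i) ->
  exists a, forall i, entry a i = if i < N then f i else 0.
Proof.
elim: N f => [|N IH] f mono.
  by exists (exist is_part [::] isT) => i; rewrite /entry /= nth_nil.
have [[s sP] Ha] := IH (fun i => f i.+1) (fun i => mono i.+1).
have [f0|f_gt0] := posnP (f 0).
  exists (exist is_part [::] isT) => i; rewrite /entry /= nth_nil; case: ifP => // _.
  by elim: i => // i; have := mono i; lia.
have tP : is_part (f 0 :: s).
  have /andP[ssort spos] := sP; move: Ha; rewrite /entry /= => {sP} Ha; rewrite /is_part /= f_gt0 spos andbT.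
  case: s ssort {spos} Ha => //= y s -> /(_ 0) /= ->; rewrite andbT.
  by case: ifP; rewrite ?mono.
exists (exist is_part _ tP) => -[|i] //; exact: Ha.
Qed.

Lemma height_entry a m : (forall i, (0 < entry a i) = (i < m)) -> height a = m.
Proof.
move=> H; apply/eqP; rewrite eqn_leq.
have := H m; have := H (height a); rewrite !entry_gt0 !ltnn; lia.
Qed.

Lemma rect_exists m n : exists a, forall i, entry a i = if i < m then n else 0.
Proof. exact: (@part_of (fun=> n)). Qed.

Lemma width_surj n : exists a, width a = n.
Proof. by have [a Ha] := rect_exists 1 n; exists a; rewrite /width Ha. Qed.

Lemma height_surj m : exists a, height a = m.
Proof.
have [a Ha] := rect_exists m 1; exists a; apply: height_entry => i.
by rewrite Ha; case: ifP.
Qed.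

Lemma arith_prog (h : nat -> nat) m d :
  (forall i, i < m -> h i = h i.+1 + d) -> h 0 = h m + m * d.
Proof.
elim: m => [|m IH] H; first by rewrite mul0n addn0.
rewrite IH ?(H m) // => [|i im]; first by rewrite mulSn addnA.
exact/H/ltnW.
Qed.

Lemma D_young i j : Dfn Ystar (fun e => young_le (e i) (e j)).
Proof.
exists (@FRel sig_Y tt (fun k => TVar sig_Y (if val k == 0 then i else j))) => e.
by rewrite /= !inordK.
Qed.

Lemma D_two_ones i : Dfn Ystar (fun e => e i = two_ones).
Proof. by exists (FEq (TVar sig_Y i) (@TCst sig_Y tt)). Qed.

(** Conjugation is an automorphism of Young's order, so a constant is what tells rows from columns:
    partitions not above [two_ones] have at most one row. *)
Lemma two_ones_le a : young_le two_ones a <-> 1 < height a.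
Proof.
rewrite young_leP -entry_gt0; split=> [/(_ 1)|H] //.
by move=> [|[|i]] //; rewrite /entry /= ?nth_nil // (leq_trans H) ?entryS.
Qed.

(** The width of a partition is that of the longest row below it, so widths compare as the sets of
    rows below do. *)
#[local] Instance width_numbering : numbering Ystar width.
Proof.
split=> [|i j]; first exact: width_surj.
apply: (@D_iff _ _ _ _ (fun e => exists c, c = two_ones /\ forall a : ypartition,
    ~ young_le c a -> young_le a (e i) -> young_le a (e j))); last first.
  by dfn; [apply: D_two_ones|apply: D_young..].
move=> e; split=> [Hw|[_ [-> H]]].
  exists two_ones; split=> // a /two_ones_le a1 /young_leP ai; apply/young_leP.
  case=> [|k]; first exact: leq_trans (ai 0) Hw.
  by rewrite entry_default //; lia.
have [a Ha] := rect_exists 1 (width (e i)).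
have row : ~ young_le two_ones a by rewrite two_ones_le -entry_gt0 Ha.
have ai : young_le a (e i) by apply/young_leP => -[|k]; rewrite Ha.
by have /young_leP/(_ 0) := H a row ai; rewrite Ha.
Qed.

Definition height_le a b : Prop := height a <= height b.

(** The same with columns, the partitions of width at most 1. *)
Lemma D_height_le i j : Dfn Ystar (fun e => height_le (e i) (e j)).
Proof.
apply: (@D_iff _ _ _ _ (fun e => forall a : ypartition, width a <= 1 ->
    young_le a (e i) -> young_le a (e j))); last by dfn; apply: D_young.
move=> e; split=> [H a a1 [ai _]|H].
  have aj := leq_trans ai H; apply/young_leP => k.
  case: (ltnP k (height a)) => [ka|/entry_default-> //].
  by apply: leq_trans (leq_trans (entry_anti a (leq0n k)) a1) _;
    rewrite entry_gt0 (leq_trans ka).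
have [a Ha] := rect_exists (height (e i)) 1.
have ha : height a = height (e i).
  by apply: height_entry => k; rewrite Ha; case: ifP.
rewrite /height_le -ha; apply: (H a _ _).1; first by rewrite /width Ha; case: ifP.
by apply/young_leP => k; rewrite Ha -entry_gt0; case: ifP.
Qed.

Definition height_succ a b : Prop := height b = (height a).+1.

Lemma D_height_succ i j : Dfn Ystar (fun e => height_succ (e i) (e j)).
Proof.
apply: (@D_iff _ _ _ _ (fun e => ~ height_le (e j) (e i) /\ forall a : ypartition,
    height_le a (e i) \/ height_le (e j) a)); last by dfn; apply: D_height_le.
rewrite /height_le /height_succ => e; split=> [->|[H]].
  by split=> [|a]; lia.
by have [a Ha] := height_surj (height (e i)).+1; move=> /(_ a); lia.
Qed.

Definition width_le_entry a b c : Prop := width c <= entry a (height b).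

(* The rectangle of width [width c] and height [(height b).+1] is the largest
   partition not exceeding these two bounds. *)
Lemma D_width_le_entry i j k :
  Dfn Ystar (fun e => width_le_entry (e i) (e j) (e k)).
Proof.
apply: (@D_iff _ _ _ _ (fun e => forall a b : ypartition, height_succ (e j) b ->
    height_le a b -> width a <= width (e k) -> young_le a (e i))); last first.
  by dfn; [apply: D_height_succ|apply: D_height_le|apply: D_young].
rewrite /width_le_entry /height_le /height_succ => e; split=> [H a b -> ab ak|H].
  apply/young_leP => l; case: (ltnP l (height a)) => [la|/entry_default-> //].
  apply: leq_trans (entry_anti a (leq0n l)) _.
  by apply: leq_trans (leq_trans ak H) (entry_anti _ _); lia.
have [a Ha] := rect_exists (height (e j)).+1 (width (e k)).
have [b Hb] := height_surj (height (e j)).+1.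
have /young_leP/(_ (height (e j))) : young_le a (e i).
  apply: (H a b); rewrite ?Hb // /width ?Ha // leqNgt -entry_gt0 Ha ltnn //.
by rewrite Ha ltnSn.
Qed.

Definition width_eq_entry a b c : Prop := width c = entry a (height b).

Lemma D_width_eq_entry i j k :
  Dfn Ystar (fun e => width_eq_entry (e i) (e j) (e k)).
Proof.
apply: (@D_iff _ _ _ _ (fun e => width_le_entry (e i) (e j) (e k) /\
    forall c : ypartition, width_le_entry (e i) (e j) c -> width c <= width (e k)));
  last by dfn; apply: D_width_le_entry.
rewrite /width_le_entry /width_eq_entry => e; split=> [-> //|[H]].
have [c Hc] := width_surj (entry (e i) (height (e j))).
by move=> /(_ c); rewrite Hc => /(_ (leqnn _)); lia.
Qed.

(* A staircase, whose parts decrease by exactly one, has equal width and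
   height. *)
Lemma D_height_width i j : Dfn Ystar (fun e => height (e i) = width (e j)).
Proof.
apply: (@D_iff _ _ _ _ (fun e => exists s, height_le (e i) s /\
    height_le s (e i) /\ width (e j) = width s /\
    forall b b' c c' : ypartition, ~ height_le s b -> height_succ b b' ->
    width_eq_entry s b c -> width_eq_entry s b' c' -> width c = (width c').+1)).
  rewrite /height_le /height_succ /width_eq_entry => e; split=> [H|].
    have [s Hs] := @part_of (fun k => height (e i) - k) (height (e i))
      ltac:(move=> k; lia).
    have hs : height s = height (e i).
      by apply: height_entry => k; rewrite Hs; case: ifP; lia.
    exists s; rewrite hs; split=> //; split=> //; split.
      by rewrite -H /width Hs; case: ifP; lia.
    move=> b b' c c' bi -> -> ->; rewrite !Hs.
    by case: ifP; case: ifP; lia.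
  move=> [s [si [is_ [-> Hs]]]].
  have {si is_} -> : height (e i) = height s by lia.
  rewrite /width (@arith_prog (entry s) (height s) 1); last first.
    move=> k ks; have [b Hb] := height_surj k; have [b' Hb'] := height_surj k.+1.
    have [c Hc] := width_surj (entry s k).
    have [c' Hc'] := width_surj (entry s k.+1).
    by rewrite addn1 -Hc -Hc'; apply: (Hs b b'); rewrite ?Hb ?Hb' //; lia.
  by rewrite entry_default // muln1.
by dfn; first [apply: D_height_le|apply: D_height_succ|apply: D_width_eq_entry].
Qed.

(** So far heights named the indices; the passage from heights to widths puts indices and parts in
    one numbering. *)
#[local] Instance def_entry : def_app Ystar width entry.
Proof.
move=> i j k; apply: (@D_iff _ _ _ _ (fun e => exists b,
    height b = width (e j) /\ width_eq_entry (e i) b (e k))).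
  rewrite /width_eq_entry => e; split=> [<-|[b [<- ->]] //].
  by have [b Hb] := height_surj (width (e j)); exists b; rewrite Hb.
apply: (D_ex (P := fun b e => height b = _ /\ _)).
by apply: D_and; [apply: D_height_width|apply: D_width_eq_entry].
Qed.

(** A descent by ones leads from the sum to one summand in as many steps as the other says. *)
#[local] Instance def_add_width : def_fun2 Ystar width addn.
Proof.
move=> i j k; apply: (@D_iff _ _ _ _ (fun e => exists x : ypartition,
    entry x 0 = width (e k) /\ entry x (width (e j)) = width (e i) /\
    forall l : nat, l < width (e j) -> entry x l = (entry x l.+1).+1)); last by dfn.
move=> e; split=> [H|[x [<- [<- Hx]]]].
  have [x Hx] := @part_of (fun l => width (e k) - l) (width (e j)).+1
    ltac:(move=> l; lia).
  exists x; rewrite !Hx ltnSn subn0; split=> //; split=> [|l lj]; first by lia.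
  by rewrite !Hx !ltnS lj ltnW //; lia.
by rewrite (@arith_prog _ (width (e j)) 1) ?muln1 // => l /Hx->; rewrite addn1.
Qed.

(** A descent in steps of [width (e i)] leads from the product to zero in [width (e j)] steps. *)
#[local] Instance def_mul_width : def_fun2 Ystar width muln.
Proof.
move=> i j k; apply: (@D_iff _ _ _ _ (fun e => exists x : ypartition,
    entry x 0 = width (e k) /\ entry x (width (e j)) = 0 /\
    forall l : nat, l < width (e j) -> entry x l = entry x l.+1 + width (e i)));
  last by dfn.
move=> e; split=> [H|[x [<- [x0 Hx]]]].
  have [x Hx] := @part_of (fun l => (width (e j) - l) * width (e i)) (width (e j))
    ltac:(move=> l; rewrite leq_mul2r; lia).
  exists x; rewrite !Hx ltnn; split.
    by rewrite -H subn0 mulnC; case: posnP => // ->; rewrite muln0.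
  split=> // l lj; rewrite !Hx lj; case: ifP => lj'; first by nia.
  (* Here [l] is the last index below [width (e j)], and the next entry is the zero beyond the
     cut. *)
  suff -> : width (e j) - l = 1 by rewrite mul1n.
  lia.
by rewrite (arith_prog Hx) x0 mulnC.
Qed.

Lemma entry_represents : represents_monotone (ent := entry).
Proof.
move=> f N mono; have [a Ha] := part_of N mono; exists a => i iN.
by rewrite Ha iN.
Qed.

(** * The code, and its sum and product, in Young's lattice *)

Lemma entry_inj a b : entry a =1 entry b -> a = b.
Proof.
move=> H; have hab : height a = height b.
  by apply: height_entry => i; rewrite H entry_gt0.
by apply: val_inj; apply: (@eq_from_nth _ 0) => // i _; apply: H.
Qed.

(** A partition represents only itself: it agrees with [s] up to the closing zero, and by
    monotonicity both vanish from there on. *)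
Lemma codes_entry a n : codes (ent := entry) a n <-> code a = n.
Proof.
split=> [[s [Hs <-]]|<-]; last by exists a.
congr code; apply: entry_inj => i; case: (leqP i (height s)) => [/Hs //|si].
rewrite [RHS]entry_default ?(ltnW si) //; apply/eqP; rewrite -leqn0.
have := entry_anti a (ltnW si); rewrite (Hs (height s)) //.
by rewrite [nth _ _ _]nth_default.
Qed.

Lemma D_code i j : Dfn Ystar (fun e => code (e i) = width (e j)).
Proof.
apply: (D_iff (Q := fun e => codes (ent := entry) (e i) (width (e j)))).
  by move=> e; rewrite codes_entry.
exact: D_codes entry_represents i j.
Qed.

(** Each code is the width of some partition, which hands the relation over to the arithmetic of
    widths. *)
Lemma D_code_rel (R : nat -> nat -> nat -> Prop) i j k :
  (forall i j k, Dfn Ystar (fun e => R (width (e i)) (width (e j)) (width (e k)))) ->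
  Dfn Ystar (fun e => R (code (e i)) (code (e j)) (code (e k))).
Proof.
move=> HR; apply: (@D_iff _ _ _ _ (fun e => exists x y z,
    (code (e i) = width x /\ code (e j) = width y /\ code (e k) = width z) /\
    R (width x) (width y) (width z))).
  move=> e; split=> [H|[x [y [z [[-> [-> ->]] //]]]]].
  have [x Hx] := width_surj (code (e i)); have [y Hy] := width_surj (code (e j)).
  have [z Hz] := width_surj (code (e k)).
  by exists x, y, z; rewrite Hx Hy Hz.
apply: (D_ex (P := fun x e => exists y z, _ /\ R _ _ _)).
apply: (D_ex (P := fun x e => exists z, _ /\ R _ _ _)).
apply: (D_ex (P := fun x e => _ /\ R _ _ _)).
by apply: D_and; [apply: D_and; [|apply: D_and]; apply: D_code|apply: HR].
Qed.

Lemma D_plus_code i j k : Dfn Ystar (fun e => plus_code (e i) (e j) (e k)).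
Proof. by apply: (@D_code_rel (fun m n p => m + n = p)) => *; dfn. Qed.

Lemma D_times_code i j k : Dfn Ystar (fun e => times_code (e i) (e j) (e k)).
Proof. by apply: (@D_code_rel (fun m n p => m * n = p)) => *; dfn. Qed.

(** * Young's order in arithmetic *)

Lemma nth_prime_inj : injective nth_prime.
Proof.
have homo : {homo nth_prime : m n / m < n}.
  by apply: homo_ltn => [k m n|k]; [apply: ltn_trans|apply: ltn_next_prime].
by move=> m n E; case: (ltngtP m n) => // /homo; rewrite E ltnn.
Qed.

Lemma prime_nth_prime n : 0 < n -> prime (nth_prime n).
Proof. by case: n => // n _; apply: prime_next_prime. Qed.

Lemma ltn_nth_prime n : n < nth_prime n.
Proof. by elim: n => // n IH; apply: leq_ltn_trans IH (ltn_next_prime _). Qed.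

Lemma nth_prime_surj p : prime p -> exists2 n, 0 < n & nth_prime n = p.
Proof.
move=> pp; have: p <= nth_prime p by apply/ltnW/ltn_nth_prime.
move: {2}p => k; elim: k => [|k IH] pk; first by have := prime_gt1 pp; rewrite ltnNge pk.
case: (leqP p (nth_prime k)) => [/IH //|kp]; exists k.+1 => //.
have [_ _ /(_ p kp pp) H] := (next_primeP (nth_prime k) _).1 erefl.
by apply/anti_leq; rewrite H.
Qed.

Lemma nth_prime_dvd_prod s y : all (leq 1) s -> 0 < y ->
  nth_prime y %| \prod_(x <- s) nth_prime x -> y \in s.
Proof.
move=> spos y0; have py := prime_nth_prime y0.
elim: s spos => [_|x s IH /= /andP[x0 /IH{}IH]].
  by rewrite big_nil dvdn1 => /eqP E; rewrite E in py.
rewrite big_cons Euclid_dvdM // inE => /orP[|/IH->]; last by rewrite orbT.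
by rewrite dvdn_prime2 ?prime_nth_prime // => /eqP/nth_prime_inj->; rewrite eqxx.
Qed.

Lemma prod_nth_prime_gt0 s : 0 < \prod_(x <- s) nth_prime x.
Proof. by rewrite prodn_gt0 // => i; apply: nth_prime_gt0. Qed.

(** The prime of the largest part of either list divides the product of the other, so that part
    occurs there and is at most its head. The heads agree and cancel. *)
Lemma prod_nth_prime_inj s t : is_part s -> is_part t ->
  \prod_(x <- s) nth_prime x = \prod_(x <- t) nth_prime x -> s = t.
Proof.
have nilE u : is_part u -> \prod_(x <- u) nth_prime x = 1 -> u = [::].
  case: u => // x u /andP[_ /= /andP[x0 _]]; rewrite big_cons => /eqP.
  by rewrite muln_eq1 => /andP[/eqP E]; have := prime_nth_prime x0; rewrite E.
have head_le y u z v : is_part (y :: u) -> is_part (z :: v) ->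
    \prod_(x <- y :: u) nth_prime x = \prod_(x <- z :: v) nth_prime x -> y <= z.
  move=> /andP[_ /= /andP[y0 _]] /andP[zv vpos] E.
  have: y \in z :: v.
    by apply: nth_prime_dvd_prod vpos y0 _; rewrite -E big_cons dvdn_mulr.
  rewrite inE => /orP[/eqP-> //|yv]; move: zv => /=.
  rewrite path_sortedE; last by move=> a b c ab bc; apply: leq_trans bc ab.
  by move=> /andP[/allP/(_ _ yv)].
elim: s t => [|y s IH] [|z t] // sP tP; rewrite ?big_nil.
- by move=> /esym/(nilE _ tP).
- by move=> /(nilE _ sP).
move=> E; have yz : y = z.
  by apply/anti_leq; rewrite (head_le _ _ _ _ sP tP) ?(head_le _ _ _ _ tP sP).
have tail x u : is_part (x :: u) -> is_part u.
  by move=> /andP[/= /path_sorted us /andP[_ upos]]; apply/andP.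
rewrite yz (IH t (tail _ _ sP) (tail _ _ tP)) //.
move: E; rewrite yz !big_cons => /eqP; rewrite eqn_pmul2l ?nth_prime_gt0 //.
by move/eqP.
Qed.

Lemma prod_nth_prime_nseq n : \prod_(x <- nseq n 1) nth_prime x = 2 ^ n.
Proof.
elim: n => [|n IH]; first by rewrite big_nil.
by rewrite [nseq _ _]/= big_cons IH nth_prime1 expnS.
Qed.

Lemma nseq1_part n : is_part (nseq n 1).
Proof.
apply/andP; split; last by rewrite all_nseq orbT.
by apply/(sortedP 0) => i; rewrite size_nseq => ni; rewrite !nth_nseq ni (ltnW ni).
Qed.

Lemma ones_nseq (s : seq nat) : ~~ has (fun x => x != 1) s -> s = nseq (size s) 1.
Proof.
by rewrite -all_predC => /allP H; apply/all_pred1P/allP => x /H /=; rewrite negbK.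
Qed.

Lemma code_seq_ones s : s != [::] -> ~~ has (fun x => x != 1) s ->
  exists2 n, s = nseq n.+1 1 & code_seq s = 2 ^ n.
Proof.
case: s => // y s _ ones; exists (size s); first exact: ones_nseq ones.
by rewrite /code_seq (negPf ones).
Qed.

Lemma code_seq_prod s : has (fun x => x != 1) s ->
  code_seq s = \prod_(x <- s) nth_prime x.
Proof. by rewrite /code_seq; case: s => // y s ->. Qed.

Lemma code_seq_gt0 s : (0 < code_seq s) = (s != [::]).
Proof.
case: s => // y s; rewrite /code_seq.
by case: ifP; rewrite ?prod_nth_prime_gt0 ?expn_gt0.
Qed.

Lemma code_inj : injective code.
Proof.
move=> [s sP] [t tP] E; apply: val_inj => /=; move: E; rewrite /code /= => E.
have [s0|sN] := eqVneq s [::].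
  by have := code_seq_gt0 t; rewrite -E s0 /= => /esym/negbFE/eqP.
have tN : t != [::] by rewrite -code_seq_gt0 -E code_seq_gt0.
(* The two clauses of the code have disjoint values: by unique factorisation a power of 2 is the
   prime product of ones only. *)
have mixed u n : is_part u -> has (fun x => x != 1) u ->
    \prod_(x <- u) nth_prime x <> 2 ^ n.
  rewrite -prod_nth_prime_nseq => uP uh /(prod_nth_prime_inj uP (nseq1_part n)) uE.
  by move: uh; rewrite uE => /hasP[x]; rewrite mem_nseq => /andP[_ ->].
case: (boolP (has (fun x => x != 1) s)) => [sh|/(code_seq_ones sN)[m sE sc]];
  case: (boolP (has (fun x => x != 1) t)) => [th|/(code_seq_ones tN)[n tE tc]].
- by apply: prod_nth_prime_inj => //; rewrite -!code_seq_prod.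
- by case: (mixed s n) => //; rewrite -tc -E code_seq_prod.
- by case: (mixed t m) => //; rewrite -sc E code_seq_prod.
by move: E; rewrite sc tc sE tE => /eqP; rewrite eqn_exp2l // => /eqP->.
Qed.

Lemma prod_nth_prime_surj n : 0 < n ->
  exists2 s, is_part s & \prod_(x <- s) nth_prime x = n.
Proof.
have [m] := ubnP n; elim: m n => // m IH n /ltnSE nm n0.
have [->|n1] := eqVneq n 1; first by exists [::]; rewrite ?big_nil.
have [p pp pn] := pdivP (ltac:(lia) : 1 < n).
have [k k0 kp] := nth_prime_surj pp.
have p1 := prime_gt1 pp; have E := divnK pn.
have [||s /andP[_ spos] sn] := IH (n %/ p); [|by rewrite divn_gt0 ?prime_gt0 // dvdn_leq|].
  by apply: leq_trans nm; rewrite ltn_Pdiv.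
exists (sort geq (k :: s)).
  apply/andP; split; first by apply: sort_sorted => a b; apply: leq_total.
  by rewrite all_sort /= k0.
by rewrite (perm_big (k :: s)) ?perm_sort //= big_cons kp sn mulnC.
Qed.

Lemma code_surj n : exists a, code a = n.
Proof.
have [->|n0] := posnP n; first by exists (exist is_part [::] isT).
have [s sP sn] := prod_nth_prime_surj n0.
case: (boolP (has (fun x => x != 1) s)) => [sh|ones].
  by exists (exist is_part _ sP); rewrite /code /= code_seq_prod.
(* Here [n] is [2 ^ size s], and the shifted exponent in the code calls for one more 1. *)
exists (exist is_part _ (nseq1_part (size s).+1)).
rewrite /code /= /code_seq [nseq _ _]/= -sn [in RHS](ones_nseq ones).
by rewrite prod_nth_prime_nseq /= has_nseq andbF size_nseq.
Qed.

(** * Chinese remainders and Goedel's beta function *)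

Lemma chinese_seq (m a : nat -> nat) N :
  (forall i j, i < j < N -> coprime (m i) (m j)) ->
  exists u, forall i, i < N -> u = a i %[mod m i].
Proof.
elim: N => [|N IH] cop; first by exists 0.
have [|u Hu] := IH; first by move=> i j /andP[ij jN]; apply: cop; rewrite ij ltnW.
pose M := \prod_(i < N) m i.
have copM : coprime M (m N).
  by rewrite /M; elim/big_ind: _ => [|x y|i _];
    rewrite ?coprime1n ?coprimeMl ?cop ?ltn_ord ?leqnn // => -> ->.
exists (chinese M (m N) u (a N)) => i; rewrite ltnS leq_eqVlt => /orP[/eqP->|iN].
  exact: chinese_modr.
have miM : m i %| M by rewrite /M (bigD1 (Ordinal iN)) //= dvdn_mulr.
by rewrite -(modn_dvdm _ miM) (chinese_modl copM) (modn_dvdm _ miM) Hu.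
Qed.

Definition beta u v i := u %% (v * i.+1).+1.

(** A common divisor is prime to [v] and divides [v * (j - i)], the difference of the moduli. Hence
    it divides [j - i], so [v], and is 1. *)
Lemma beta_coprime v i j : i < j -> j - i %| v ->
  coprime (v * i.+1).+1 (v * j.+1).+1.
Proof.
move=> ij jiv; rewrite /coprime; apply/eqP; set d := gcdn _ _.
have di : d %| (v * i.+1).+1 by apply: dvdn_gcdl.
have dj : d %| (v * j.+1).+1 by apply: dvdn_gcdr.
have dv : coprime d v.
  by apply: coprime_dvdl di (coprime_dvdr (dvdn_mulr i.+1 (dvdnn v)) (coprimeSn _)).
have dji : d %| (j - i).
  rewrite -(Gauss_dvdr _ dv); have -> : v * (j - i) = (v * j.+1).+1 - (v * i.+1).+1.
    by nia.
  exact: dvdn_sub.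
by apply/eqP; move: dv; rewrite /coprime (gcdn_idPl (dvdn_trans dji jiv)).
Qed.

Lemma beta_exists (a : nat -> nat) N :
  exists u v, forall i, i < N -> beta u v i = a i.
Proof.
(* With [v] the factorial of [M], all differences of indices divide [v], and every modulus exceeds
   the remainder [a i] wanted of it. *)
pose M := N + \max_(i < N) a i.
have [|u Hu] := @chinese_seq (fun i => (M`! * i.+1).+1) a N.
  move=> i j /andP[ij jN]; apply: (beta_coprime ij).
  by apply: dvdn_fact; rewrite subn_gt0 ij /M; lia.
exists u, M`! => i iN; rewrite /beta Hu // modn_small // ltnS.
have aM : a i <= M.
  apply: leq_trans (leq_addl _ _).
  exact: (@leq_bigmax _ (fun i : 'I_N => a i) (Ordinal iN)).
apply: leq_trans aM _; apply: leq_trans (leq_pmulr _ _) => //.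
by elim: (M) => // k; rewrite factS; have := fact_gt0 k; nia.
Qed.

Lemma isqrt_subproof n : exists r, n < r.+1 * r.+1.
Proof. by exists n; nia. Qed.
Definition isqrt n := ex_minn (isqrt_subproof n).

Lemma isqrtP n r : isqrt n = r <-> r * r <= n < r.+1 * r.+1.
Proof.
rewrite /isqrt; case: ex_minnP => q qn qmin.
have sq : q * q <= n.
  by case: q {qn} qmin => // q qmin; rewrite leqNgt; apply/negP => /qmin; rewrite ltnn.
split=> [<-|/andP[rn nr]]; first by rewrite sq.
by have := qmin _ nr; nia.
Qed.

(* The number [(u + v) ^ 2 + u] names the pair [(u, v)]; since
   [u <= 2 * (u + v)], its integer square root is [u + v]. *)
Definition beta_entry (x : ypartition) i :=
  let r := isqrt (code x) in let u := code x - r * r in beta u (r - u) i.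

Lemma beta_entry_exists (f : nat -> nat) N :
  exists x, forall i, i < N -> beta_entry x i = f i.
Proof.
have [u [v Huv]] := beta_exists f N.
have [x Hx] := code_surj ((u + v) * (u + v) + u); exists x => i iN.
rewrite /beta_entry Hx (_ : isqrt _ = u + v); last by apply/isqrtP; nia.
by rewrite addKn addKn Huv.
Qed.

(** * Definability through codes in arithmetic *)

Lemma D_plus i j k : Dfn Arith (fun e => plus_code (e i) (e j) (e k)).
Proof.
exists (@FRel sig_A true (fun l => TVar sig_A (if val l is 0 then i
  else if val l is 1 then j else k))) => e.
by rewrite /= !inordK.
Qed.

Lemma D_times i j k : Dfn Arith (fun e => times_code (e i) (e j) (e k)).
Proof.
exists (@FRel sig_A false (fun l => TVar sig_A (if val l is 0 then i
  else if val l is 1 then j else k))) => e.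
by rewrite /= !inordK.
Qed.

#[local] Instance code_numbering : numbering Arith code.
Proof.
split=> [|i j]; first exact: code_surj.
apply: (@D_iff _ _ _ _ (fun e => exists c, plus_code (e i) c (e j))).
  rewrite /plus_code => e; split=> [H|[c]]; last by lia.
  by have [c Hc] := code_surj (code (e j) - code (e i)); exists c; lia.
by dfn; apply: D_plus.
Qed.

#[local] Instance def_add_code : def_fun2 Arith code addn := D_plus.
#[local] Instance def_mul_code : def_fun2 Arith code muln := D_times.

(** Polynomial conditions replace the operations: [u <= 2 * r] makes [r] the integer square root,
    the disjunction expresses the truncated difference [v] of [r] and [u], and [q] is the quotient
    of the division. *)
#[local] Instance def_beta_entry : def_app Arith code beta_entry.
Proof.
move=> i j k; apply: (@D_iff _ _ _ _ (fun e => exists r u v q : nat,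
    code (e i) = r * r + u /\ u <= 2 * r /\
    (r = u + v \/ (r <= u /\ v = 0)) /\
    u = q * (v * (code (e j)).+1).+1 + code (e k) /\
    code (e k) < (v * (code (e j)).+1).+1)); last by dfn.
rewrite /beta_entry /beta => e.
set n := code (e i); set c := code (e k); set b := (code (e j)).+1.
split=> [<-|[r [u [v [q [nE [ur [rv [uE cE]]]]]]]]].
  have /andP[] := (isqrtP n _).1 erefl; set r := isqrt n => rn nr.
  set u := n - r * r; exists r, u, (r - u), (u %/ ((r - u) * b).+1).
  rewrite -divn_eq ltn_pmod //; split; first by rewrite subnKC.
  by split; [nia|split; [lia|]].
have -> : isqrt n = r by apply/isqrtP; nia.
have -> : n - r * r = u by lia.
have -> : r - u = v by lia.
by rewrite uE modnMDl modn_small.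
Qed.

Lemma beta_entry_represents : represents_monotone (ent := beta_entry).
Proof. by move=> f N _; apply: beta_entry_exists. Qed.

(** As the code is injective, it determines the partition, which makes [represents] definable in
    arithmetic. *)
Lemma codes_code (ent : ypartition -> nat -> nat) x a :
  codes (ent := ent) x (code a) <-> represents (ent := ent) x a.
Proof. by split=> [[s [Hs /code_inj <-]]|] //; exists a. Qed.

(** Past the closing zero the terms of [x] are arbitrary, so positivity is asked of all terms up to
    [i]. *)
Lemma represents_height (ent : ypartition -> nat -> nat) x a i :
  represents (ent := ent) x a ->
  (i < height a <-> forall j, j <= i -> 0 < ent x j).
Proof.
move=> Hx; split=> [ia j ji|H].
  have ja := leq_ltn_trans ji ia.
  by rewrite Hx ?(ltnW ja) // -[nth _ _ _]/(entry a j) entry_gt0.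
rewrite ltnNge; apply/negP => /H; rewrite Hx //.
by rewrite nth_default.
Qed.

Lemma D_young_code i j : Dfn Arith (fun e => young_le (e i) (e j)).
Proof.
apply: (@D_iff _ _ _ _ (fun e => exists x y : ypartition,
    codes (ent := beta_entry) x (code (e i)) /\
    codes (ent := beta_entry) y (code (e j)) /\
    forall k : nat, (forall l : nat, l <= k -> 0 < beta_entry x l) ->
      (forall l : nat, l <= k -> 0 < beta_entry y l) /\
      beta_entry x k <= beta_entry y k)); last first.
  by dfn; apply: (D_codes beta_entry_represents).
move=> e; split=> [[ij H]|[x [y [/codes_code Hx [/codes_code Hy H]]]]].
  have rep a : exists x, represents (ent := beta_entry) x a.
    have [x Hx] := beta_entry_exists (entry a) (height a).+1.
    by exists x => k ka; rewrite Hx.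
  have [[x Hx] [y Hy]] := (rep (e i), rep (e j)).
  exists x, y; split; [exact/codes_code|split; [exact/codes_code|]] => k.
  move=> /(represents_height _ Hx) ki; have kj := leq_trans ki ij.
  split; first exact/(represents_height _ Hy).
  by rewrite Hx ?Hy ?H // ltnW.
have lt k : k < height (e i) -> k < height (e j) /\ entry (e i) k <= entry (e j) k.
  move=> ki; have [/(represents_height _ Hy) kj] := H k ((represents_height _ Hx).1 ki).
  by rewrite Hx ?Hy // ltnW.
split=> [|k /lt[] //].
by rewrite leqNgt; apply/negP => /lt[]; rewrite ltnn.
Qed.

Lemma D_two_ones_code i : Dfn Arith (fun e => e i = two_ones).
Proof.
(* Two ones have code [2 ^ (2 - 1) = 2]. *)
apply: (@D_iff _ _ _ _ (fun e => code (e i) = 2)); last by dfn.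
by move=> e; split=> [->//|E]; apply: code_inj.
Qed.

(** Both structures share their universe, so connectives and quantifiers carry over unchanged and
    only atomic formulas need a translation. *)
Lemma Dfn_interp (S S' : signature) U (A : structure S U) (B : structure S' U) :
  (forall (r : rsym S) (ts : 'I_(rar r) -> term S),
     Dfn B (fun e => @rint _ _ A r (fun i => teval A e (ts i)))) ->
  (forall t1 t2, Dfn B (fun e => teval A e t1 = teval A e t2)) ->
  forall P, Dfn A P -> Dfn B P.
Proof.
move=> Hrel Heq P [phi /D_iff]; apply => {P}.
elim: phi => [|t1 t2|r ts|g IH|g IHg h IHh|g IHg h IHh|g IHg h IHh
             |n g [psi H]|n g [psi H]] /=.
- by exists (FFalse S').
- exact: Heq.
- exact: Hrel.
- exact: D_not.
- exact: D_and.
- exact: D_or.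
- exact: D_imp.
- by exists (FEx n psi) => e /=; split=> -[a Ha]; exists a; apply/H.
- by exists (FAll n psi) => e /=; split=> Ha a; apply/H.
Qed.

Theorem theorem4p4 :
  forall (k : nat) (R : ('I_k -> ypartition) -> Prop),
    definable Ystar R <-> definable Arith R.
Proof.
(* By conversion, [definable] is [Dfn] for the predicate [fun e => R (fun i => e i)]. *)
move=> k R; split; apply: Dfn_interp.
(* An argument of the order may be the constant, so both arguments are named by two new variables;
   hence the shift by two. *)
- have Dt i t : Dfn Arith (fun e => e i = teval Ystar (fun n => e n.+2) t).
    by case: t => [n|[]]; [apply: D_eq|apply: D_two_ones_code].
  move=> [] ts; apply: (@D_iff _ _ _ _ (fun e => exists a b,
    b = teval Ystar e (ts (inord 0)) /\ a = teval Ystar e (ts (inord 1)) /\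
    young_le b a)).
    by move=> e; split=> [H|[a [b [-> [->]]]]] //; do 2 eexists.
  apply: (D_ex (P := fun a e => exists b, _ /\ _ /\ _)).
  apply: (D_ex (P := fun b e => _ /\ _ /\ _)).
  apply: D_and; first exact: Dt.
  by apply: D_and; [apply: Dt|apply: D_young_code].
- move=> [n|[]] [m|[]] /=; [exact: D_eq|exact: D_two_ones_code| |].
    by apply: D_iff (D_two_ones_code m) => e; split.
  by exists (FNot (FFalse _)); split=> // _ [].
- case=> ts /=; case: (ts (inord 0)) (ts (inord 1)) (ts (inord 2))
    => [a|[]] [b|[]] [c|[]]; [exact: D_plus_code|exact: D_times_code].
- by move=> [n|[]] [m|[]]; apply: D_eq.
Qed.
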